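(* Let $\mathbb{F}$ be an infinite field of characteristic $p\neq 2$, let $n=3$ and let $d>0$ be an integer. Then the set $$\sigma_2(Z_i)\ (1\le i\le d),\qquad \operatorname{tr}(Z_iZ_j)\ (1\le i<j\le d),\qquad \operatorname{tr}(Z_iZ_jZ_k)\ (1\le i<j<k\le d)$$ is a minimal (with respect to inclusion) separating set for the algebra $R_-^{O(3)}$ of $O(3)$-invariants of $d$ skew-symmetric $3\times3$ matrices.
   Context: Let $R_-=\mathbb{F}[x_{ij}(k)\mid 1\le j<i\le n,\ 1\le k\le d]$, and let $Z_k$ ($1\le k\le d$) be the $n\times n$ skew-symmetric generic matrix with $(i,j)$ entry $x_{ij}(k)$ if $i>j$, $0$ if $i=j$, and $-x_{ji}(k)$ if $i<j$. For an $n\times n$ matrix $A$ over a commutative ring, $\sigma_t(A)$ denotes the $t$-th coefficient of the characteristic polynomial, normalized by $\det(\lambda I-A)=\sum_{t=0}^n(-1)^t\sigma_t(A)\lambda^{n-t}$; so $\sigma_1=\operatorname{tr}$, $\sigma_n=\det$. Let $M(n)$ be the space of $n\times n$ matrices over $\mathbb{F}$, $S_-(n)=\{A\in M(n)\mid A^T=-A\}$, $O(n)=\{A\in M(n)\mid AA^T=I_n\}$, and $H_-=S_-(n)^{\oplus d}$, on which $O(n)$ acts by $g\cdot(A_1,\ldots,A_d)=(gA_1g^{-1},\ldots,gA_dg^{-1})$. Elements of $R_-$ are regarded as polynomial functions $H_-\to\mathbb{F}$, where $x_{ij}(k)$ sends $(A_1,\ldots,A_d)$ to the $(i,j)$ entry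 of $A_k$. The algebra $R_-^{O(n)}=\{f\in R_-\mid f(g\cdot v)=f(v)\ \text{for all } g\in O(n),\ v\in H_-\}$ is (by a known theorem, for $p\ne2$) the $\mathbb{F}$-subalgebra of $R_-$ generated by all $\sigma_t(b)$, where $1\le t\le n$ and $b$ ranges over all monomials in $Z_1,\ldots,Z_d$. A subset $S\subset R_-^{O(n)}$ separates $u,v\in H_-$ if there is $f\in S$ with $f(u)\ne f(v)$. The set $S$ is called separating if any $u,v\in H_-$ that are separated by $R_-^{O(n)}$ are separated by $S$. A separating set is minimal if no proper subset of it is separating. *)

(* Defs.v *)
From mathcomp Require Import all_boot all_order all_algebra.
From mathcomp Require Import classical_sets cardinality.
From mathcomp Require Import mpoly.

Set Implicit Arguments.
Unset Strict Implicit.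
Unset Printing Implicit Defensive.

Import GRing.Theory.
Local Open Scope ring_scope.
Local Open Scope classical_set_scope.

(* det (lambda I - A) = \sum_(t <= n) (-1)^t sigma_t(A) lambda^(n - t);
   meaningful for t <= n only. *)
Definition sigma (R : comNzRingType) (n t : nat) (A : 'M[R]_n) : R :=
  (-1) ^+ t * (char_poly A)`_(n - t).

(* The triple (i, j, k) with j < i indexes the indeterminate x_ij(k). *)
Notation skew_var n d :=
  {a : 'I_n * 'I_n * 'I_d | (a.1.2 < a.1.1)%N}.

Notation Rminus F n d := {mpoly F[#|{: skew_var n d}|]}.

Section Skew.
Variables (F : fieldType) (n d : nat).

Local Notation R := (Rminus F n d).

(* The indeterminate x_ij(k) when j < i; a dummy 0 otherwise. *)
Definition xvar (i j : 'I_n) (k : 'I_d) : R :=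
  if insub (i, j, k) is Some a then 'X_(enum_rank (a : skew_var n d)) else 0.

Definition gen_skew (k : 'I_d) : 'M[R]_n :=
  \matrix_(i, j) (if (j < i)%N then xvar i j k
                  else if (i < j)%N then - xvar j i k else 0).

Definition Sminus : set 'M[F]_n := [set A | A^T = - A].

Definition orthogonal_group : set 'M[F]_n := [set A | A *m A^T = 1%:M].

Definition Hminus : set {ffun 'I_d -> 'M[F]_n} :=
  [set v | forall k, Sminus (v k)].

Definition conj_act (g : 'M[F]_n) (v : {ffun 'I_d -> 'M[F]_n}) :
  {ffun 'I_d -> 'M[F]_n} := [ffun k => g *m v k *m invmx g].

Definition eval_at (f : R) (v : {ffun 'I_d -> 'M[F]_n}) : F :=
  f.@[fun m => let: (i, j, k) := val (enum_val m) in v k i j].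

Definition invariants : set R :=
  [set f | forall g v, orthogonal_group g -> Hminus v ->
     eval_at f (conj_act g v) = eval_at f v].

Definition separates (S : set R) (u v : {ffun 'I_d -> 'M[F]_n}) : Prop :=
  exists2 f, S f & eval_at f u <> eval_at f v.

Definition separating (S : set R) : Prop :=
  S `<=` invariants /\
  forall u v, Hminus u -> Hminus v ->
    separates invariants u v -> separates S u v.

Definition minimal_separating (S : set R) : Prop :=
  separating S /\ forall S', S' `<` S -> ~ separating S'.

End Skew.

(* Main.v *)
Require Import Defs.
From mathcomp Require Import all_boot all_order all_algebra.
From mathcomp Require Import classical_sets cardinality.
From mathcomp Require Import mpoly.
From mathcomp Require Import boolp finmap ring.

Set Implicit Arguments.
Unset Strict Implicit.
Unset Printing Implicit Defensive.

Import GRing.Theory.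
Local Open Scope ring_scope.
Local Open Scope classical_set_scope.

(** A skew-symmetric 3 x 3 matrix is the matrix of the cross product with a
    vector, its axis; conjugation by [g] in SO(3) moves the axis by [g]. In these
    terms the generators are, up to nonzero scalars, the scalar products and the
    triple products of the axes, so it has to be shown that these determine the
    values of all invariants over the given infinite field. If some triple
    product, or some squared norm of [U i x U j], is nonzero, then matching
    frames produce an element of SO(3) carrying one tuple to the other. Otherwise
    the tuple spans an anisotropic line or is orthogonal to an isotropic vector
    [n]. In the latter case a split torus scales the [n]-components by any
    [t != 0], and letting [t] tend to 0 in the polynomial identity replaces the
    tuple by one on an anisotropic line; tuples on such lines are matched by
    half-turns. For minimality, each generator is isolated by a pair of tuples
    made of standard basis vectors. *)

(** * Enumeration of the three indices *)

Local Notation i0 := (@Ordinal 3 0 isT).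
Local Notation i1 := (@Ordinal 3 1 isT).
Local Notation i2 := (@Ordinal 3 2 isT).

Lemma ord3P (i : 'I_3) : [\/ i = i0, i = i1 | i = i2].
Proof.
by case: i => [[|[|[|//]]] lt_i3]; [apply: Or31|apply: Or32|apply: Or33];
  apply: val_inj.
Qed.

Lemma forall_ord3 (P : 'I_3 -> Prop) :
  P i0 -> P i1 -> P i2 -> forall i, P i.
Proof. by move=> P0 P1 P2 i; case: (ord3P i) => ->. Qed.

Lemma sum_ord3 (V : nmodType) (f : 'I_3 -> V) :
  \sum_i f i = f i0 + f i1 + f i2.
Proof.
rewrite !big_ord_recr big_ord0 /= add0r.
by congr (f _ + f _ + f _); apply: val_inj.
Qed.

(** * Scalar, cross and triple products, and skew matrices *)

Section Vectors.
Variable R : comNzRingType.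
Implicit Types (a b c : 'cV[R]_3) (A : 'M[R]_3).

Definition col3 (x y z : R) : 'cV[R]_3 := \col_i [:: x; y; z]`_i.

Definition dotv a b : R :=
  a i0 0 * b i0 0 + a i1 0 * b i1 0 + a i2 0 * b i2 0.

Definition crossv a b : 'cV[R]_3 :=
  col3 (a i1 0 * b i2 0 - a i2 0 * b i1 0)
       (a i2 0 * b i0 0 - a i0 0 * b i2 0)
       (a i0 0 * b i1 0 - a i1 0 * b i0 0).

Definition cols3 a b c : 'M[R]_3 :=
  \matrix_(i, j) [:: a i 0; b i 0; c i 0]`_j.

(* The matrix of [b |-> crossv a b]. *)
Definition skew_of a : 'M[R]_3 :=
  \matrix_(i, j) (nth [::] [:: [:: 0; - a i2 0; a i1 0];
                              [:: a i2 0; 0; - a i0 0];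
                              [:: - a i1 0; a i0 0; 0]] i)`_j.

(** Inverse to [skew_of] on skew-symmetric matrices with zero diagonal. *)
Definition axis A : 'cV[R]_3 := col3 (A i2 i1) (A i0 i2) (A i1 i0).

Lemma colP3 a b : a i0 0 = b i0 0 -> a i1 0 = b i1 0 -> a i2 0 = b i2 0 ->
  a = b.
Proof.
by move=> e0 e1 e2; apply/colP; apply: forall_ord3.
Qed.

Lemma dotvC a b : dotv a b = dotv b a.
Proof. rewrite /dotv; ring. Qed.

Lemma dotvZl x a b : dotv (x *: a) b = x * dotv a b.
Proof. rewrite /dotv !mxE; ring. Qed.

Lemma dotvZr x a b : dotv a (x *: b) = x * dotv a b.
Proof. rewrite /dotv !mxE; ring. Qed.

Lemma dotvDl a b c : dotv (a + b) c = dotv a c + dotv b c.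
Proof. rewrite /dotv !mxE; ring. Qed.

Lemma dotvDr a b c : dotv a (b + c) = dotv a b + dotv a c.
Proof. rewrite /dotv !mxE; ring. Qed.

Lemma dotvBl a b c : dotv (a - b) c = dotv a c - dotv b c.
Proof. rewrite /dotv !mxE; ring. Qed.

Lemma dotvBr a b c : dotv a (b - c) = dotv a b - dotv a c.
Proof. rewrite /dotv !mxE; ring. Qed.

Lemma dotv_crossv a b c d :
  dotv (crossv a b) (crossv c d) = dotv a c * dotv b d - dotv a d * dotv b c.
Proof. rewrite /dotv !mxE /=; ring. Qed.

Lemma dotv_cross_l a b : dotv (crossv a b) a = 0.
Proof. rewrite /dotv !mxE /=; ring. Qed.

Lemma dotv_cross_r a b : dotv (crossv a b) b = 0.
Proof. rewrite /dotv !mxE /=; ring. Qed.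

Lemma det_mx3 A : \det A = dotv (crossv (col i0 A) (col i1 A)) (col i2 A).
Proof.
(* Indexing entries by naturals lets [ring] identify equal entries however their ordinals are
   built. *)
pose B k l := A (inord k) (inord l).
have EB : A = \matrix_(i, j) B i j.
  by apply/matrixP=> i j; rewrite mxE /B !inord_val.
rewrite {}EB (expand_det_row _ i0) sum_ord3 /cofactor !(expand_det_row _ ord0).
rewrite !big_ord_recl !big_ord0 /cofactor !det_mx11 /dotv !mxE /=.
rewrite /bump /=; ring.
Qed.

Lemma trmx_skew_of a : (skew_of a)^T = - skew_of a.
Proof.
by apply/matrixP; do 2!apply: forall_ord3; rewrite !mxE /= ?opprK ?oppr0.
Qed.

Lemma mxtrace_skew_of2 a b :
  \tr (skew_of a *m skew_of b) = - (dotv a b *+ 2).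
Proof. rewrite /mxtrace sum_ord3 !mxE !sum_ord3 !mxE /= /dotv; ring. Qed.

Lemma mxtrace_skew_of3 a b c :
  \tr (skew_of a *m skew_of b *m skew_of c) = - dotv (crossv a b) c.
Proof.
rewrite /mxtrace sum_ord3 !mxE !sum_ord3 !mxE !sum_ord3 !mxE /= /dotv !mxE /=.
ring.
Qed.

(** The matrix applied to [a] on the right is the cofactor matrix of [A]; the identity is polynomial
    in the entries. *)
Lemma mulmx_skew_of_cofactor A a :
  A *m skew_of a *m A^T = skew_of (cols3 (crossv (col i1 A) (col i2 A))
   (crossv (col i2 A) (col i0 A)) (crossv (col i0 A) (col i1 A)) *m a).
Proof.
apply/matrixP; do 2!apply: forall_ord3.
all: rewrite [LHS]mxE [LHS]sum_ord3.
all: rewrite [LHS]/= ![in LHS]mxE.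
all: rewrite !sum_ord3.
all: rewrite !mxE /= ?sum_ord3 ?mxE /=.
all: ring.
Qed.

Lemma mulmx_skew_of_tr A a : \det A = 1 -> A^T *m A = 1%:M ->
  A *m skew_of a *m A^T = skew_of (A *m a).
Proof.
move=> detA trAA; have AtrA := mulmx1C trAA.
(* The transposed cofactor matrix is the adjugate, so it and [A^T] are both left inverses of [A],
   hence equal. *)
have trBA : (cols3 (crossv (col i1 A) (col i2 A))
   (crossv (col i2 A) (col i0 A)) (crossv (col i0 A) (col i1 A)))^T *m A = 1%:M.
  rewrite -detA; apply/matrixP; do 2!apply: forall_ord3;
  rewrite !mxE sum_ord3 ?mxE /= ?(mulr1n, mulr0n) ?det_mx3 /dotv ?mxE /=; ring.
rewrite mulmx_skew_of_cofactor; congr (skew_of (_ *m _)).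
by apply: trmx_inj; rewrite -[LHS]mulmx1 -AtrA mulmxA trBA mul1mx.
Qed.

End Vectors.

Lemma sigma2_skew_of (R : comNzRingType) (a : 'cV[R]_3) :
  sigma 2 (skew_of a) = dotv a a.
Proof.
rewrite /sigma sqrrN expr1n mul1r.
have -> : char_poly (skew_of a) = 'X ^+ 3 + (dotv a a)%:P * 'X.
  rewrite /char_poly det_mx3 /dotv !mxE /= !(mulr0n, mulr1n) /dotv.
  ring.
by rewrite coefD coefXn coefMX coefC add0r.
Qed.

(** * Axes of skew tuples and values of the generators *)

Section Evaluation.
Variables (F : fieldType) (d : nat).
Hypothesis F_char : 2%N \notin [pchar F].
Implicit Types (U V W : 'I_d -> 'cV[F]_3) (P Q : 'M[F]_3)
  (f g : Rminus F 3 d) (v : {ffun 'I_d -> 'M[F]_3}).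

Local Notation Z := (@gen_skew F 3 d).

Definition skew_tuple U : {ffun 'I_d -> 'M[F]_3} := [ffun k => skew_of (U k)].

(** The minus sign arises because the indeterminates sit below the diagonal, where [skew_of a] has
    [- a i1 0] in position [(i2, i0)]. *)
Definition gen_axis (k : 'I_d) : 'cV[Rminus F 3 d]_3 :=
  col3 (xvar F i2 i1 k) (- xvar F i2 i0 k) (xvar F i1 i0 k).

Lemma gen_skewE k : Z k = skew_of (gen_axis k).
Proof.
by apply/matrixP; do 2!apply: forall_ord3; rewrite !mxE /= ?opprK.
Qed.

Lemma two_neq0 : 2%:R != 0 :> F.
Proof. by move: F_char; rewrite inE /=. Qed.

Lemma Hminus_skew_tuple U : Hminus (skew_tuple U).
Proof. by move=> k; rewrite ffunE; exact: trmx_skew_of. Qed.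

Lemma HminusE (v : {ffun 'I_d -> 'M[F]_3}) :
  Hminus v -> v = skew_tuple (fun k => axis (v k)).
Proof.
move=> Hv; apply/ffunP=> k; rewrite ffunE.
have skv i j : v k j i = - v k i j.
  by move/matrixP/(_ i j): (Hv k); rewrite !mxE.
(* Skew-symmetry makes twice the diagonal entry zero, and 2 is invertible. *)
have diag0 i : v k i i = 0.
  apply/eqP; have /eqP := skv i i; rewrite -addr_eq0 -mulr2n -mulr_natl.
  by rewrite mulf_eq0 (negPf two_neq0).
by apply/matrixP; do 2!apply: forall_ord3; rewrite !mxE /= ?diag0.
Qed.

Lemma eval_xvar v (i j : 'I_3) k : (j < i)%N ->
  eval_at (@xvar F 3 d i j k) v = v k i j.
Proof.
move=> lt_ji; rewrite /eval_at /xvar; case: insubP => [a _ Ea|].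
  by rewrite mevalXU enum_rankK Ea.
by rewrite /= lt_ji.
Qed.

Lemma eval_atD f g v : eval_at (f + g) v = eval_at f v + eval_at g v.
Proof. exact: mevalD. Qed.

Lemma eval_atN f v : eval_at (- f) v = - eval_at f v.
Proof. exact: mevalN. Qed.

Lemma eval_atM f g v : eval_at (f * g) v = eval_at f v * eval_at g v.
Proof. exact: mevalM. Qed.

Definition eval_atE := (eval_atD, eval_atN, eval_atM).

Lemma eval_gen_axis U k i : eval_at (gen_axis k i 0) (skew_tuple U) = U k i 0.
Proof.
case: (ord3P i) => ->; rewrite !mxE /= ?eval_atN eval_xvar //;
by rewrite ffunE !mxE ?opprK.
Qed.

Lemma eval_sigma2 U i :
  eval_at (sigma 2 (Z i)) (skew_tuple U) = dotv (U i) (U i).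
Proof.
by rewrite gen_skewE sigma2_skew_of /dotv !eval_atE !eval_gen_axis.
Qed.

Lemma eval_tr2 U i j :
  eval_at (\tr (Z i *m Z j)) (skew_tuple U) = - (dotv (U i) (U j) *+ 2).
Proof.
rewrite !gen_skewE mxtrace_skew_of2 /dotv !mulr2n !eval_atE.
by rewrite !eval_gen_axis.
Qed.

Lemma eval_tr3 U i j k :
  eval_at (\tr (Z i *m Z j *m Z k)) (skew_tuple U) =
  - dotv (crossv (U i) (U j)) (U k).
Proof.
rewrite !gen_skewE mxtrace_skew_of3 eval_atN; congr (- _).
have := (eval_gen_axis U i, eval_gen_axis U j, eval_gen_axis U k).
move: (gen_axis i) (gen_axis j) (gen_axis k) => a b c /= E.
by rewrite /dotv !mxE /= !eval_atE !E.

Qed.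

Lemma orthogonal_unit n (g : 'M[F]_n) : orthogonal_group g -> g \in unitmx.
Proof. by move=> /mulmx1_unit[]. Qed.

Lemma invmx_orthogonal n (g : 'M[F]_n) : orthogonal_group g -> invmx g = g^T.
Proof.
move=> og; rewrite -[LHS]mulmx1 -[1%:M]og mulmxA.
by rewrite mulVmx ?mul1mx ?orthogonal_unit.
Qed.

Lemma Hminus_conj_act n (g : 'M[F]_n) (v : {ffun 'I_d -> 'M[F]_n}) :
  orthogonal_group g -> Hminus v -> Hminus (conj_act g v).
Proof.
move=> og Hv k; rewrite ffunE invmx_orthogonal // /Sminus /=.
by rewrite !trmx_mul trmxK (Hv k) mulNmx mulmxN mulmxA.
Qed.

Definition generator (f : Rminus F 3 d) : Prop :=
  [\/ exists i, f = sigma 2 (Z i),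
      exists i j : 'I_d, (i < j)%N /\ f = \tr (Z i *m Z j) |
      exists i j k : 'I_d, (i < j < k)%N /\ f = \tr (Z i *m Z j *m Z k)].

(** Traces are invariant under conjugation and yield, after division by 2, the scalar products of
    the axes, and up to sign their triple products. *)
Lemma generator_invariant f : generator f -> invariants f.
Proof.
move=> gen_f g v og Hv; have ug := orthogonal_unit og.
have Hgv := Hminus_conj_act og Hv.
set w := conj_act g v in Hgv *.
have [U EU] : exists U, v = skew_tuple U.
  by exists (fun k => axis (v k)); exact: HminusE.
have [W EW] : exists W, w = skew_tuple W.
  by exists (fun k => axis (w k)); exact: HminusE.
have Wk k : skew_of (W k) = g *m skew_of (U k) *m invmx g.
  by move/ffunP/(_ k): (EW); rewrite /w EU !ffunE => <-.
have dotE i j : dotv (W i) (W j) = dotv (U i) (U j).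
  apply/(mulfI two_neq0)/oppr_inj; rewrite !mulr_natl -!mxtrace_skew_of2 !Wk.
  rewrite mxtrace_mulC !mulmxA mulmxKV // mxtrace_mulC !mulmxA.
  by rewrite mulVmx // mul1mx mxtrace_mulC.
rewrite EW EU; case: gen_f => [[i]|[i [j [_]]]|[i [j [k [_]]]]] ->.
- by rewrite !eval_sigma2 dotE.
- by rewrite !eval_tr2 dotE.
- rewrite !eval_tr3 -!mxtrace_skew_of3 !Wk !mulmxA !mulmxKV //.
  by rewrite mxtrace_mulC !mulmxA mulVmx // mul1mx.
Qed.

(* [Q *m invmx P] lies in SO(3) and carries [U] to [V]. *)
Lemma eval_gram_basis P Q U V f :
    P^T *m P = Q^T *m Q -> \det P = \det Q -> \det P != 0 ->
    (forall k, P^T *m U k = Q^T *m V k) -> invariants f ->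
  eval_at f (skew_tuple U) = eval_at f (skew_tuple V).
Proof.
move=> PP detPQ detP UV inv_f.
have uP : P \in unitmx by rewrite unitmxE unitfE.
have uQ : Q \in unitmx by rewrite unitmxE unitfE -detPQ.
have uQT : Q^T \in unitmx by rewrite unitmx_tr.
pose h := Q *m invmx P.
have hTh : h^T *m h = 1%:M.
  rewrite trmx_mul mulmxA -(mulmxA _ Q^T) -PP mulmxA -mulmxA mulmxV // mulmx1.
  by rewrite -trmx_mul mulmxV // trmx1.
have og : orthogonal_group h by exact: mulmx1C.
have deth : \det h = 1 by rewrite det_mulmx det_inv -detPQ divff.
(* As [Q^T Q = P^T P], multiplying by the invertible [Q^T] turns this into the hypothesis on [U k]
   and [V k]. *)
have hU k : h *m U k = V k.
  apply: (can_inj (mulKmx uQT)).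
  by rewrite -UV /h !mulmxA -PP -(mulmxA P^T) mulmxV // mulmx1.
have <- : conj_act h (skew_tuple U) = skew_tuple V.
  apply/ffunP=> k; rewrite !ffunE invmx_orthogonal //.
  by rewrite mulmx_skew_of_tr // hU.
by rewrite inv_f //; exact: Hminus_skew_tuple.
Qed.

End Evaluation.

(** * Polynomial identities over an infinite field and the limit at 0 *)

Section Orbits.
Variables (F : fieldType) (d : nat).
Hypothesis F_infinite : infinite_set [set: F].
Hypothesis F_char : 2%N \notin [pchar F].
Implicit Types (U V W : 'I_d -> 'cV[F]_3) (a b c n m w : 'cV[F]_3)
  (f g : Rminus F 3 d).

Lemma poly_infinite_eq0 (p : {poly F}) : (forall t, p.[t] = 0) -> p = 0.
Proof.
move=> p0; apply/eqP/negPn/negP=> nz_p.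
have [B _ szB] := infinite_set_fset (size p) F_infinite.
suff: (#|` B| < size p)%N by rewrite ltnNge szB.
apply: max_poly_roots (fset_uniq B) => //.
by apply/allP=> t _; rewrite /root p0.
Qed.

Lemma eval_line_poly f U V : exists p : {poly F}, forall t,
  p.[t] = eval_at f (skew_tuple (fun k => U k + t *: V k)).
Proof.
(* Each indeterminate is replaced by its affine function along the line, with ['X] in the role of
   [t]. *)
pose h (x : 'I_#|{: skew_var 3 d}|) : {poly F} :=
  let: (i, j, k) := val (enum_val x) in
  (skew_of (U k) i j)%:P + (skew_of (V k) i j)%:P * 'X.
exists (mmap polyC h f) => t.
rewrite /eval_at /meval /mmap horner_sum; apply: eq_bigr => x _.
rewrite hornerM hornerC; congr (_ * _); rewrite /mmap1 horner_prod.
apply: eq_bigr => y _; rewrite horner_exp; congr (_ ^+ _).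
rewrite /h; case: (val _) => [[i j] k]; rewrite ffunE !hornerE.
by case: (ord3P i) => ->; case: (ord3P j) => ->; rewrite !mxE /=; ring.
Qed.

(** Algebraic form of letting [t] tend to 0: over an infinite field, a polynomial that is constant
    off 0 is constant. *)
Lemma eval_line_const f U V :
    (forall t, t != 0 ->
       eval_at f (skew_tuple (fun k => U k + t *: V k)) =
       eval_at f (skew_tuple (fun k => U k + V k))) ->
  eval_at f (skew_tuple (fun k => U k + V k)) = eval_at f (skew_tuple U).
Proof.
have [p pE] := eval_line_poly f U V => const_f.
set e := eval_at f _.
(* The factor ['X] makes the product vanish at [t = 0] as well. *)
have : ('X * (p - e%:P)) = 0.
  apply: poly_infinite_eq0 => t; rewrite !hornerE.
  have [->|nz_t] := eqVneq t 0; first by rewrite mul0r.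
  by rewrite pE const_f // subrr mulr0.
move/eqP; rewrite mulf_eq0 polyX_eq0 /= subr_eq0 => /eqP p_e.
have := pE 0; rewrite p_e hornerC => ->; congr (eval_at f _).
by apply/ffunP=> k; rewrite !ffunE scale0r addr0.
Qed.

(** * Frames and isotropic vectors *)

Lemma col_cols3 a b c :
  [/\ col i0 (cols3 a b c) = a, col i1 (cols3 a b c) = b
    & col i2 (cols3 a b c) = c].
Proof. by split; apply/colP=> i; rewrite !mxE. Qed.

Lemma det_cols3 a b c : \det (cols3 a b c) = dotv (crossv a b) c.
Proof. by rewrite det_mx3; case: (col_cols3 a b c) => -> -> ->. Qed.

Lemma mul_tr_cols3 a b c w :
  (cols3 a b c)^T *m w = col3 (dotv a w) (dotv b w) (dotv c w).
Proof. by apply: colP3; rewrite !mxE sum_ord3 !mxE. Qed.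

Lemma mulmx_tr_dotv (P Q : 'M[F]_3) i j :
  (P^T *m Q) i j = dotv (col i P) (col j Q).
Proof. by rewrite mxE sum_ord3 /dotv !mxE. Qed.

(** With the frames as columns of [P] and [Q], the Gram matrices are [P^T P] and [Q^T Q], and the
    triple products are the determinants. *)
Lemma eval_frame f a b c a' b' c' U V :
    dotv a a = dotv a' a' -> dotv b b = dotv b' b' -> dotv c c = dotv c' c' ->
    dotv a b = dotv a' b' -> dotv a c = dotv a' c' -> dotv b c = dotv b' c' ->
    dotv (crossv a b) c = dotv (crossv a' b') c' ->
    dotv (crossv a b) c != 0 ->
    (forall k, [/\ dotv a (U k) = dotv a' (V k), dotv b (U k) = dotv b' (V k)
                 & dotv c (U k) = dotv c' (V k)]) ->
    invariants f ->
  eval_at f (skew_tuple U) = eval_at f (skew_tuple V).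
Proof.
move=> eaa ebb ecc eab eac ebc edet det0 UV.
apply: (@eval_gram_basis _ _ (cols3 a b c) (cols3 a' b' c')).
- apply/matrixP=> i j; rewrite !mulmx_tr_dotv.
  have [[E0 E1 E2] [E0' E1' E2']] := (col_cols3 a b c, col_cols3 a' b' c').
  by case: (ord3P i) => ->; case: (ord3P j) => ->;
    rewrite ?E0 ?E1 ?E2 ?E0' ?E1' ?E2' // dotvC 1?[RHS]dotvC.
- by rewrite !det_cols3.
- by rewrite det_cols3.
- by move=> k; rewrite !mul_tr_cols3; case: (UV k) => -> -> ->.
Qed.

Lemma frame_eq a b c x y : dotv (crossv a b) c != 0 ->
  dotv a x = dotv a y -> dotv b x = dotv b y -> dotv c x = dotv c y -> x = y.
Proof.
move=> det0 ea eb ec; have uP : (cols3 a b c)^T \in unitmx.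
  by rewrite unitmx_tr unitmxE unitfE det_cols3.
by apply: (can_inj (mulKmx uP)); rewrite !mul_tr_cols3 ea eb ec.
Qed.

Lemma dotv_crossvCA a b c : dotv (crossv a b) c = dotv (crossv b c) a.
Proof. by rewrite /dotv !mxE /=; ring. Qed.

Lemma crossvZr x a b : crossv a (x *: b) = x *: crossv a b.
Proof. by apply: colP3; rewrite !mxE /=; ring. Qed.

Lemma exists_dotv_neq0 a : a != 0 -> exists b, dotv a b != 0.
Proof.
move=> nz_a; have [i nz_ai] : exists i, a i 0 != 0.
  apply/existsP; apply: contraR nz_a => /existsPn a0; apply/eqP/colP=> i.
  by rewrite mxE; apply/eqP/negPn/a0.
exists (delta_mx i 0); apply: contraNneq nz_ai => <-; apply/eqP.
by case: (ord3P i) => ->; rewrite /dotv !mxE /=; ring.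
Qed.

Lemma exists_hyperbolic n : n != 0 -> dotv n n = 0 ->
  exists m, dotv m m = 0 /\ dotv n m = 1.
Proof.
move=> nz_n nn0; have [a na0] := exists_dotv_neq0 nz_n.
have two0 := two_neq0 F_char.
have [b nb] : exists b, dotv n b = 1.
  by exists ((dotv n a)^-1 *: a); rewrite dotvZr mulVf.
(* As [n] is isotropic, this correction keeps the product with [n] and makes the squared norm
   vanish. *)
exists (b - (dotv b b / 2%:R) *: n).
rewrite !(dotvBl, dotvBr, dotvZl, dotvZr) nn0 (dotvC b n) nb.
by split; field.
Qed.

(* The torus fixing [crossv n m] and scaling [n] contracts the orthogonal
   complement of [n] to the line of [crossv n m]. *)
Lemma eval_isotropic_normal f U n : invariants f -> n != 0 -> dotv n n = 0 ->
    (forall k, dotv n (U k) = 0) ->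
  exists c s, [/\ dotv c c != 0,
    forall i j, dotv (U i) (U j) = dotv (s i *: c) (s j *: c) &
    eval_at f (skew_tuple U) = eval_at f (skew_tuple (fun k => s k *: c))].
Proof.
move=> inv_f nz_n nn0 nU; have [m [mm0 nm1]] := exists_hyperbolic nz_n nn0.
(* [c] completes the hyperbolic pair to a frame; its squared norm is -1, hence the sign in [s]. *)
pose c := crossv n m.
have cc : dotv c c = -1 by rewrite dotv_crossv nn0 (dotvC m) nm1; ring.
pose s k := - dotv c (U k).
have cn : dotv c n = 0 by exact: dotv_cross_l.
have cm : dotv c m = 0 by exact: dotv_cross_r.
have det_cnm : dotv (crossv c n) m = -1 by rewrite dotv_crossvCA.
have UE k : U k = s k *: c + dotv m (U k) *: n.
  apply: (@frame_eq c n m); first by rewrite det_cnm oppr_eq0 oner_eq0.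
  - by rewrite dotvDr !dotvZr cc cn /s; ring.
  - by rewrite dotvDr !dotvZr nn0 (dotvC n c) cn nU; ring.
  - by rewrite dotvDr !dotvZr (dotvC m c) cm (dotvC m n) nm1; ring.
exists c, s; split; first by rewrite cc oppr_eq0 oner_eq0.
  move=> i j; rewrite (UE i) (UE j).
  by rewrite !(dotvDl, dotvDr, dotvZl, dotvZr) nn0 cn (dotvC n c) cn; ring.
have -> : skew_tuple U = skew_tuple (fun k => s k *: c + dotv m (U k) *: n).
  by apply/ffunP=> k; rewrite !ffunE -UE.
apply: eval_line_const => t nz_t; symmetry.
(* The torus element sends [c], [n], [m] to [c], [t n], [t^-1 m], a frame with the same Gram matrix
   and triple product. *)
apply: (@eval_frame _ c n m c (t *: n) (t^-1 *: m)) => //;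
  rewrite ?(dotvZl, dotvZr) ?cc ?nn0 ?mm0 ?cn ?cm ?nm1 ?mulr0 ?mulr1 ?mulfV //.
- by rewrite crossvZr dotvZl mulrA mulVf // mul1r.
- by rewrite det_cnm oppr_eq0 oner_eq0.
- move=> k; rewrite !(dotvDr, dotvZl, dotvZr) nn0 cn cc (dotvC n c) cn.
  rewrite (dotvC m c) cm (dotvC m n) nm1.
  by split; field.
Qed.

(** * Half-turns and tuples on an anisotropic line *)

Definition half_turn w a : 'cV[F]_3 := (2%:R * dotv w a / dotv w w) *: w - a.

Lemma half_turn_dotv w a b : dotv w w != 0 ->
  dotv (half_turn w a) (half_turn w b) = dotv a b.
Proof.
move=> ww0; rewrite !(dotvBl, dotvBr, dotvZl, dotvZr) (dotvC a w); field.
exact: ww0.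
Qed.

Lemma half_turn_adj w a b : dotv (half_turn w a) b = dotv a (half_turn w b).
Proof. by rewrite !(dotvBl, dotvBr, dotvZl, dotvZr) (dotvC a w); ring. Qed.

Lemma half_turn_det w a b c : dotv w w != 0 ->
  dotv (crossv (half_turn w a) (half_turn w b)) (half_turn w c) =
  dotv (crossv a b) c.
Proof.
move=> ww0.
(* Multilinear expansion: terms containing [w] twice vanish. *)
have expand x y z : dotv (crossv (x *: w - a) (y *: w - b)) (z *: w - c) =
    x * dotv (crossv w b) c + y * dotv (crossv a w) c + z * dotv (crossv a b) w
    - dotv (crossv a b) c.
  by rewrite /dotv !mxE /=; ring.
(* Cramer's rule expressing [w] through [a], [b], [c], paired with [w]. *)
have cramer : dotv w a * dotv (crossv w b) c + dotv w b * dotv (crossv a w) c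
    + dotv w c * dotv (crossv a b) w = dotv w w * dotv (crossv a b) c.
  by rewrite /dotv !mxE /=; ring.
rewrite /half_turn {}expand; move: cramer ww0.
move: (dotv (crossv w b) c) (dotv (crossv a w) c) (dotv (crossv a b) w).
move: (dotv (crossv a b) c) (dotv w a) (dotv w b) (dotv w c) (dotv w w).
move=> D x y z q X Y Z E q0.
have -> : 2%:R * x / q * X + 2%:R * y / q * Y + 2%:R * z / q * Z - D =
  2%:R * (x * X + y * Y + z * Z) / q - D by ring.
by rewrite E; field.
Qed.

(** A half-turn is a self-adjoint rotation, so the turned standard basis has the same products with
    [U k] as the standard basis with [V k]. *)
Lemma eval_half_turn f w U V : invariants f -> dotv w w != 0 ->
    (forall k, half_turn w (U k) = V k) ->
  eval_at f (skew_tuple U) = eval_at f (skew_tuple V).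
Proof.
move=> inv_f ww0 UV; pose e (i : 'I_3) : 'cV[F]_3 := delta_mx i 0.
have det_e : dotv (crossv (e i0) (e i1)) (e i2) = 1.
  by rewrite /dotv !mxE /=; ring.
apply: (@eval_frame _ (half_turn w (e i0)) (half_turn w (e i1))
  (half_turn w (e i2)) (e i0) (e i1) (e i2)); rewrite ?half_turn_dotv //.
- exact: half_turn_det.
- by rewrite half_turn_det // det_e oner_eq0.
- by move=> k; rewrite !half_turn_adj UV.
Qed.

(** The cross products of [a] with the standard basis are orthogonal to [a], and their squared norms
    add up to [2 (a . a)]. *)
Lemma exists_orthogonal a : dotv a a != 0 ->
  exists w, dotv w a = 0 /\ dotv w w != 0.
Proof.
move=> aa0; pose w i := crossv a (delta_mx i 0 : 'cV[F]_3).
have [i ww0] : exists i, dotv (w i) (w i) != 0.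
  apply/existsP; apply: contraR aa0 => /existsPn w0.
  have ww i : dotv (w i) (w i) = 0 by apply/eqP/negPn/w0.
  have : 2%:R * dotv a a = 0.
    have -> : 2%:R * dotv a a = \sum_i dotv (w i) (w i).
      by rewrite sum_ord3 /dotv !mxE /=; ring.
    by rewrite big1.
  by move/eqP; rewrite mulf_eq0 (negPf (two_neq0 F_char)).
by exists (w i); split=> //; exact: dotv_cross_l.
Qed.

Lemma eval_line f a b (s : 'I_d -> F) : invariants f ->
    dotv a a = dotv b b -> dotv a a != 0 ->
  eval_at f (skew_tuple (fun k => s k *: a)) =
  eval_at f (skew_tuple (fun k => s k *: b)).
Proof.
move=> inv_f; have two0 := two_neq0 F_char.
(* [half_turn (a + b)] swaps [a] and [b]. *)
have swap a' b' : dotv a' a' = dotv b' b' -> dotv (a' + b') (a' + b') != 0 ->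
    eval_at f (skew_tuple (fun k => s k *: a')) =
    eval_at f (skew_tuple (fun k => s k *: b')).
  move=> eab ww0; apply: (eval_half_turn inv_f ww0) => k.
  have -> : half_turn (a' + b') (s k *: a') =
      (2%:R * dotv (a' + b') a' / dotv (a' + b') (a' + b') * s k) *: (a' + b')
      - s k *: a'.
    by rewrite /half_turn dotvZr; congr (_ *: _ - _); ring.
  have -> : 2%:R * dotv (a' + b') a' = dotv (a' + b') (a' + b').
    by rewrite !(dotvDl, dotvDr) -eab (dotvC b'); ring.
  by rewrite divff // mul1r scalerDr addrC addKr.
move=> eab aa0; have [ww0|] := boolP (dotv (a + b) (a + b) != 0).
  exact: swap.
rewrite negbK => /eqP ww0.
(* If [a + b] is isotropic, a half-turn about [w] first replaces [a] by [- a]; by the parallelogram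
   law [- a + b] then has squared norm [4 (a . a)]. *)
have [w [wa ww]] := exists_orthogonal aa0.
transitivity (eval_at f (skew_tuple (fun k => s k *: - a))).
  apply: (eval_half_turn inv_f ww) => k.
  by rewrite /half_turn dotvZr wa !mulr0 mul0r scale0r sub0r scalerN.
have eNa : dotv (- a) (- a) = dotv a a by rewrite /dotv !mxE; ring.
apply: swap; first by rewrite eNa.
have -> : dotv (- a + b) (- a + b) =
    2%:R * 2%:R * dotv a a - dotv (a + b) (a + b).
  rewrite !(dotvDl, dotvDr) eNa -eab (dotvC b (- a)) (dotvC b a).
  have -> : dotv (- a) b = - dotv a b by rewrite /dotv !mxE; ring.
  ring.
by rewrite ww0 subr0 !mulf_neq0.
Qed.

(** If [s i] is nonzero, the [i]-th entries have equal squared norms, and both tuples have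
    coordinates [s k / s i] along them. *)
Lemma eval_rank1 f a b (s t : 'I_d -> F) : invariants f ->
    dotv a a != 0 -> dotv b b != 0 ->
    (forall i j, dotv (s i *: a) (s j *: a) = dotv (t i *: b) (t j *: b)) ->
  eval_at f (skew_tuple (fun k => s k *: a)) =
  eval_at f (skew_tuple (fun k => t k *: b)).
Proof.
move=> inv_f aa0 bb0 st.
have {}st i j : s i * (s j * dotv a a) = t i * (t j * dotv b b).
  by have := st i j; rewrite !(dotvZl, dotvZr).
have ts0 i : (t i == 0) = (s i == 0).
  have := st i i; case: (eqVneq (s i) 0) => [->|si0].
    by rewrite !mul0r => /esym/eqP; rewrite !mulf_eq0 (negPf bb0) orbF orbb.
  case: eqVneq => // ->; rewrite !mul0r => /eqP.
  by rewrite !mulf_eq0 (negPf aa0) (negPf si0).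
have [/existsP[i si0]|/existsPn s0] := boolP [exists i, s i != 0]; last first.
  congr (eval_at f _); apply/ffunP=> k; rewrite !ffunE.
  have /negPn/eqP sk := s0 k; rewrite sk.
  have -> : t k = 0 by apply/eqP; rewrite ts0 sk.
  by rewrite !scale0r.
have ti0 : t i != 0 by rewrite ts0.
transitivity (eval_at f (skew_tuple (fun k => (s k / s i) *: (s i *: a)))).
  by congr (eval_at f _); apply/ffunP=> k; rewrite !ffunE scalerA divfK.
transitivity (eval_at f (skew_tuple (fun k => (s k / s i) *: (t i *: b)))).
  by apply: eval_line => //; rewrite !(dotvZl, dotvZr) ?st // !mulf_neq0.
congr (eval_at f _); apply/ffunP=> k; rewrite !ffunE scalerA.
congr (skew_of (_ *: _)); apply: (mulIf (mulf_neq0 ti0 bb0)).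
by rewrite -(st k i) -(mulrA _ (t i)) -(st i i) mulrA divfK.
Qed.

(** * Degenerate tuples and the comparison of invariants *)

Lemma crossv_crossv c a b :
  crossv c (crossv a b) = dotv c b *: a - dotv c a *: b.
Proof. by apply: colP3; rewrite /dotv !mxE /=; ring. Qed.

Lemma crossv_eq0_colinear a b : a != 0 -> crossv a b = 0 ->
  exists x, b = x *: a.
Proof.
move=> nz_a ab0; have [c nz_ac] := exists_dotv_neq0 nz_a.
exists ((dotv a c)^-1 * dotv c b).
have := crossv_crossv c a b; rewrite ab0.
have -> : crossv c 0 = 0 by apply: colP3; rewrite !mxE /= !mulr0 subrr.
move/esym/eqP; rewrite subr_eq0 -scalerA => /eqP ->.
by rewrite (dotvC c) scalerK.
Qed.

(** A nonzero cross product of two entries is isotropic and orthogonal to all entries. Otherwise the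
    entries lie on one line, whose direction is anisotropic or else its own isotropic normal. *)
Lemma eval_degenerate f U : invariants f ->
    (forall i j k, dotv (crossv (U i) (U j)) (U k) = 0) ->
    (forall i j, dotv (crossv (U i) (U j)) (crossv (U i) (U j)) = 0) ->
  exists c s, [/\ dotv c c != 0,
    forall i j, dotv (U i) (U j) = dotv (s i *: c) (s j *: c) &
    eval_at f (skew_tuple U) = eval_at f (skew_tuple (fun k => s k *: c))].
Proof.
move=> inv_f det0 minor0.
have [/existsP[i /existsP[j nz_n]]|] :=
    boolP [exists i, exists j, crossv (U i) (U j) != 0].
  exact: (eval_isotropic_normal inv_f nz_n (minor0 i j) (det0 i j)).
move=> /existsPn cross0.
have {}cross0 i j : crossv (U i) (U j) = 0.
  by apply/eqP/negPn; move/existsPn: (cross0 i); apply.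
have [/existsP[i nz_Ui]|/existsPn U0] := boolP [exists i, U i != 0]; last first.
  (* For the zero tuple any anisotropic vector serves. *)
  pose e : 'cV[F]_3 := col3 1 0 0.
  have UE k : U k = 0 *: e by rewrite scale0r; apply/eqP/negPn/U0.
  exists e, (fun=> 0); split.
  - by rewrite /dotv !mxE /= !mulr0 mulr1 !addr0 oner_eq0.
  - by move=> i j; rewrite !UE.
  - by congr (eval_at f _); apply/ffunP=> k; rewrite !ffunE UE.
have [s UE] : exists s, forall k, U k = s k *: U i.
  by apply: (fin_all_exists (P := fun k x => U k = x *: U i)) => k;
    exact: crossv_eq0_colinear.
have [Uii|] := boolP (dotv (U i) (U i) != 0).
  exists (U i), s; split=> // [j k|]; first by rewrite -!UE.
  by congr (eval_at f _); apply/ffunP=> k; rewrite !ffunE -UE.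
rewrite negbK => /eqP Uii.
by apply: (eval_isotropic_normal inv_f nz_Ui) => // k;
  rewrite (UE k) dotvZr Uii mulr0.
Qed.

Lemma eval_gram_det f U V : invariants f ->
    (forall i j, dotv (U i) (U j) = dotv (V i) (V j)) ->
    (forall i j k, dotv (crossv (U i) (U j)) (U k) =
                   dotv (crossv (V i) (V j)) (V k)) ->
  eval_at f (skew_tuple U) = eval_at f (skew_tuple V).
Proof.
move=> inv_f dotE detE.
(* Squared norms of cross products are 2 by 2 Gram minors. *)
have minorE i j : dotv (crossv (U i) (U j)) (crossv (U i) (U j)) =
    dotv (crossv (V i) (V j)) (crossv (V i) (V j)).
  by rewrite !dotv_crossv !dotE.
have [/existsP[i /existsP[j /existsP[k det0]]]|/existsPn det0] :=
    boolP [exists i, exists j, exists k, dotv (crossv (U i) (U j)) (U k) != 0].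
  exact: (@eval_frame _ (U i) (U j) (U k) (V i) (V j) (V k)).
have {}det0 i j k : dotv (crossv (U i) (U j)) (U k) = 0.
  apply/eqP/negPn; move/existsPn/(_ j)/existsPn: (det0 i); exact.
have [/existsP[i /existsP[j minor0]]|/existsPn minor0] := boolP [exists i,
    exists j, dotv (crossv (U i) (U j)) (crossv (U i) (U j)) != 0].
  (* The triple product of this frame is the nonzero squared norm; its third vector pairs with the
     tuple in triple products. *)
  apply: (@eval_frame _ (U i) (U j) (crossv (U i) (U j))
                        (V i) (V j) (crossv (V i) (V j))) => //;
  by rewrite ![dotv _ (crossv _ _)]dotvC !(dotv_cross_l, dotv_cross_r).
have {}minor0 i j : dotv (crossv (U i) (U j)) (crossv (U i) (U j)) = 0.
  apply/eqP/negPn; move/existsPn: (minor0 i); exact.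
(* Both tuples are replaced by tuples on anisotropic lines with the same Gram matrices. *)
have [a [s [aa0 Us ->]]] := eval_degenerate inv_f det0 minor0.
have [||b [t [bb0 Vt ->]]] := @eval_degenerate f V inv_f.
- by move=> *; rewrite -detE.
- by move=> *; rewrite -minorE.
by apply: eval_rank1 => // i j; rewrite -Us -Vt.
Qed.

End Orbits.

(** * Gram matrix and triple products from the generators *)

Section Generators.
Variables (F : fieldType) (d : nat).
Hypothesis F_char : 2%N \notin [pchar F].
Implicit Types (U V : 'I_d -> 'cV[F]_3) (f g : Rminus F 3 d).

Local Notation Z := (@gen_skew F 3 d).

(** Adjacent swaps sort any triple at the cost of a sign, and a repeated index gives zero. *)
Lemma alternating_ext (D E : 'I_d -> 'I_d -> 'I_d -> F) :
    (forall i k, D i i k = 0) -> (forall i k, D i k k = 0) ->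
    (forall i j k, D j i k = - D i j k) ->
    (forall i j k, D i k j = - D i j k) ->
    (forall i k, E i i k = 0) -> (forall i k, E i k k = 0) ->
    (forall i j k, E j i k = - E i j k) ->
    (forall i j k, E i k j = - E i j k) ->
    (forall i j k : 'I_d, (i < j < k)%N -> D i j k = E i j k) ->
  forall i j k, D i j k = E i j k.
Proof.
move=> D1 D2 D3 D4 E1 E2 E3 E4 DE.
have DE' (i j k : 'I_d) : (i < j)%N -> D i j k = E i j k.
  move=> lt_ij; case: (ltngtP j k) => [lt_jk|lt_kj|/val_inj <-].
  - by rewrite DE ?lt_ij.
  - rewrite D4 E4; congr (- _); case: (ltngtP i k) => [lt_ik|lt_ki|/val_inj <-].
    + by rewrite DE ?lt_ik.
    + by rewrite D3 E3 DE ?lt_ki.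
    + by rewrite D1 E1.
  - by rewrite D2 E2.
move=> i j k; case: (ltngtP i j) => [|lt_ji|/val_inj <-]; first exact: DE'.
  by rewrite D3 E3 DE'.
by rewrite D1 E1.
Qed.

Lemma eval_generators_gram U V :
    (forall f, generator f ->
       eval_at f (skew_tuple U) = eval_at f (skew_tuple V)) ->
  (forall i j, dotv (U i) (U j) = dotv (V i) (V j)) /\
  (forall i j k, dotv (crossv (U i) (U j)) (U k) =
                 dotv (crossv (V i) (V j)) (V k)).
Proof.
move=> UV; split.
  have dot_lt (i j : 'I_d) : (i < j)%N -> dotv (U i) (U j) = dotv (V i) (V j).
    move=> lt_ij; have /UV : generator (\tr (Z i *m Z j)).
      by apply: Or32; exists i, j.
    rewrite !eval_tr2 => /oppr_inj; rewrite -[LHS]mulr_natl -[RHS]mulr_natl.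
    exact: (mulfI (two_neq0 F_char)).
  move=> i j; case: (ltngtP i j) => [|lt_ji|/val_inj <-]; first exact: dot_lt.
    by rewrite dotvC dot_lt // dotvC.
  have /UV : generator (sigma 2 (Z i)) by apply: Or31; exists i.
  by rewrite !eval_sigma2.
apply: alternating_ext; rewrite /dotv; try by move=> *; rewrite !mxE /=; ring.
move=> i j k lt_ijk; apply: oppr_inj.
rewrite -/(dotv (crossv (U i) (U j)) (U k)) -/(dotv (crossv (V i) (V j)) (V k)).
by rewrite -!eval_tr3; apply: UV; apply: Or33; exists i, j, k.
Qed.

(** * Pairs of tuples isolating each generator *)

(** If both factors were 1, then [a = j > i = b]. This removes terms matching increasing indices in
    the wrong order. *)
Lemma mul_inversion (a b i j : 'I_d) : (a < b)%N -> (i < j)%N ->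
  (a == j)%:R * (b == i)%:R = 0 :> F.
Proof.
move=> lt_ab lt_ij; rewrite -natrM mulnb.
case: eqP => //= aj; case: eqP => //= bi.
by move: lt_ab; rewrite aj bi ltnNge ltnW.
Qed.

Lemma crossv_planar (a b c : 'cV[F]_3) :
  a i2 0 = 0 -> b i2 0 = 0 -> c i2 0 = 0 ->
  dotv (crossv a b) c = 0 :> F.
Proof. by move=> a0 b0 c0; rewrite /dotv !mxE /= a0 b0 c0; ring. Qed.

Lemma generator_independent f : generator f ->
  exists U V, eval_at f (skew_tuple U) <> eval_at f (skew_tuple V) /\
    forall g, generator g -> g <> f ->
      eval_at g (skew_tuple U) = eval_at g (skew_tuple V).
Proof.
have two0 := two_neq0 F_char.
case=> [[i]|[i [j [lt_ij]]]|[i [j [k [/andP[lt_ij lt_jk]]]]]] Ef.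
(* A single nonzero entry makes all products of distinct entries vanish. *)
- exists (fun a => col3 (a == i)%:R 0 0), (fun=> 0).
  have V0 c : dotv (0 : 'cV[F]_3) c = 0 by rewrite /dotv !mxE !mul0r !addr0.
  split=> [|g gen_g ne_gf].
    rewrite Ef !eval_sigma2 V0 /dotv !mxE /= eqxx !mulr0 mulr1 !addr0.
    by apply/eqP/oner_neq0.
  case: gen_g => [[a]|[a [b [lt_ab]]]|[a [b [c [_]]]]] Eg.
  + rewrite Eg !eval_sigma2 V0 /dotv !mxE /=.
    have /negPf -> : a != i.
      by apply/eqP=> ai; case: ne_gf; rewrite {}Eg {}Ef ai.
    by rewrite !mulr0 !addr0.
  + rewrite Eg !eval_tr2 V0 /dotv !mxE /= -natrM mulnb.
    case: eqP => [ai|_]; case: eqP => [bi|_] /=; rewrite ?mulr0 ?addr0 //.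
    by move: lt_ab; rewrite ai bi ltnn.
  + by rewrite Eg !eval_tr3 !crossv_planar ?mxE.
- have lt_ij0 : (j == i) = false by rewrite -val_eqE gtn_eqF.
  (* Entries [i] and [j] are equal unit vectors here and orthogonal ones in the next tuple; norms
     agree, and planarity makes triple products vanish. *)
  exists (fun a => col3 ((a == i)%:R + (a == j)%:R) 0 0).
  exists (fun a => col3 (a == i)%:R (a == j)%:R 0).
  have lt_ij1 : (i == j) = false by rewrite eq_sym.
  split=> [|g gen_g ne_gf].
    rewrite Ef !eval_tr2 /dotv !mxE /= !eqxx lt_ij0 lt_ij1.
    rewrite !(mulr0, mul0r, mulr1, addr0, add0r) mul0rn oppr0.
    by apply/eqP; rewrite oppr_eq0.
  case: gen_g => [[a]|[a [b [lt_ab]]]|[a [b [c [_]]]]] Eg.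
  + rewrite Eg !eval_sigma2 /dotv !mxE /=.
    have aij : (a == i)%:R * (a == j)%:R = 0 :> F.
      by case: eqP => [->|_]; rewrite ?lt_ij1 ?mulr0 ?mul0r.
    apply/subr0_eq; transitivity (2%:R * ((a == i)%:R * (a == j)%:R) : F).
      ring.
    by rewrite aij mulr0.
  + rewrite Eg !eval_tr2 /dotv !mxE /=; congr (- (_ *+ 2)).
    have ba : (a == j)%:R * (b == i)%:R = 0 :> F by exact: mul_inversion.
    have ab : (a == i)%:R * (b == j)%:R = 0 :> F.
      rewrite -natrM mulnb; case: eqP => //= ai; case: eqP => //= bj.
      by case: ne_gf; rewrite {}Eg {}Ef ai bj.
    apply/subr0_eq; transitivity
      ((a == i)%:R * (b == j)%:R + (a == j)%:R * (b == i)%:R : F).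
      by ring.
    by rewrite ab ba addr0.
  + by rewrite Eg !eval_tr3 !crossv_planar ?mxE.
have lt_ik := ltn_trans lt_ij lt_jk.
(* [s = 1] and [s = -1] give opposite orientations with the same Gram matrix. *)
pose U s (a : 'I_d) : 'cV[F]_3 :=
  col3 (a == i)%:R (a == j)%:R (s * (a == k)%:R).
have detU s (a b c : 'I_d) : (a < b)%N -> (b < c)%N ->
    dotv (crossv (U s a) (U s b)) (U s c) =
    s * ((a == i)%:R * (b == j)%:R * (c == k)%:R).
  move=> lt_ab lt_bc; have lt_ac := ltn_trans lt_ab lt_bc.
  (* Each of the five other permutations in the determinant contains an inversion. *)
  have z1 : (b == k)%:R * (c == j)%:R = 0 :> F by exact: mul_inversion.
  have z2 : (a == j)%:R * (b == i)%:R = 0 :> F by exact: mul_inversion.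
  have z3 : (a == j)%:R * (c == i)%:R = 0 :> F by exact: mul_inversion.
  have z4 : (a == k)%:R * (b == i)%:R = 0 :> F by exact: mul_inversion.
  have z5 : (a == k)%:R * (c == i)%:R = 0 :> F by exact: mul_inversion.
  rewrite /dotv !mxE /=.
  transitivity (s * ((a == i)%:R * (b == j)%:R * (c == k)%:R
    - (a == i)%:R * ((b == k)%:R * (c == j)%:R)
    - (c == k)%:R * ((a == j)%:R * (b == i)%:R)
    + (b == k)%:R * ((a == j)%:R * (c == i)%:R)
    + (c == j)%:R * ((a == k)%:R * (b == i)%:R)
    - (b == j)%:R * ((a == k)%:R * (c == i)%:R))); first by ring.
  by rewrite z1 z2 z3 z4 z5 !mulr0 !subr0 !addr0.
exists (U 1), (U (-1)); split=> [|g gen_g ne_gf].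
  rewrite Ef !eval_tr3 !detU // !eqxx !mulr1 opprK; apply/eqP.
  by rewrite eq_sym -subr_eq0 opprK -mulr2n.
case: gen_g => [[a]|[a [b [lt_ab]]]|[a [b [c [/andP[lt_ab lt_bc]]]]]] Eg.
- by rewrite Eg !eval_sigma2 /dotv !mxE /=; ring.
- by rewrite Eg !eval_tr2 /dotv !mxE /=; ring.
rewrite Eg !eval_tr3 !detU //.
suff -> : (a == i)%:R * (b == j)%:R * (c == k)%:R = 0 :> F by rewrite !mulr0.
rewrite -!natrM !mulnb; case: eqP => //= ai; case: eqP => //= bj.
by case: eqP => //= ck; case: ne_gf; rewrite {}Eg {}Ef ai bj ck.
Qed.

End Generators.

Theorem theorem4p2 (F : fieldType) (d : nat)
    (F_infinite : infinite_set [set: F]) (F_char : 2%N \notin [pchar F])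
    (d_gt0 : (0 < d)%N) :
  let Z : 'I_d -> 'M[Rminus F 3 d]_3 := @gen_skew F 3 d in
  minimal_separating
    ([set f : Rminus F 3 d | exists i : 'I_d, f = sigma 2 (Z i)] `|`
     [set f : Rminus F 3 d | exists i j : 'I_d, (i < j)%N /\ f = \tr (Z i *m Z j)] `|`
     [set f : Rminus F 3 d | exists i j k : 'I_d, (i < j < k)%N /\ f = \tr (Z i *m Z j *m Z k)]).

Proof.
move=> Z; set S := (X in minimal_separating X).
have S_gen f : S f <-> generator f.
  split=> [[[]|]|[]] ?; [exact: Or31|exact: Or32|exact: Or33| | |].
  - by left; left.
  - by left; right.
  - by right.
have S_inv : S `<=` @invariants F 3 d.
  by move=> f /S_gen; exact: generator_invariant.
split.
  (* If no generator separates [u] and [v], their axes share Gram matrix and triple products, so no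
     invariant separates them. *)
  split=> // u v Hu Hv [f inv_f ne_uv]; apply: contrapT => nsep; apply: ne_uv.
  rewrite (HminusE F_char Hu) (HminusE F_char Hv) in nsep *.
  have [g /S_gen gen_g|dotE detE] := @eval_generators_gram F d F_char
      (fun k => axis (u k)) (fun k => axis (v k)).
    by apply: contrapT => ne_g; apply: nsep; exists g => //; apply/S_gen.
  exact: eval_gram_det.
move=> S' [sub_S'S not_sub] [_ sep_S']; apply: not_sub => f Sf.
apply: contrapT => S'f.
(* The omitted [f] is the only generator separating this pair, so [S'] cannot separate it. *)
have [U [V [ne_f eq_g]]] := generator_independent F_char ((S_gen f).1 Sf).
have [] := sep_S' _ _ (Hminus_skew_tuple U) (Hminus_skew_tuple V).
  by exists f => //; exact: S_inv.
move=> g S'g; apply; apply: eq_g; first exact/S_gen/sub_S'S.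
by move=> gf; apply: S'f; rewrite -gf.
Qed.
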